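(* For $p>0$ let $$F_p = \Big\{0, \frac{1}{1^p}, \frac{1}{2^p},\frac{1}{3^p},\ldots \Big\}\subset\mathbb{R}.$$ Then for all $p>0$ and $0\leq \theta \leq 1$, $$\underline{\dim}_{\theta} F_p = \overline{\dim}_\theta F_p = \frac{\theta}{p+\theta}.$$
   Context: For a set $U\subseteq\mathbb{R}$, $|U|$ denotes its diameter. A cover $\{U_i\}$ of $F$ is a finite or countable collection of sets with $F\subseteq\bigcup_i U_i$. For bounded $F\subseteq\mathbb{R}$ and $0\leq\theta\leq 1$, the lower $\theta$-intermediate dimension $\underline{\dim}_{\theta} F$ is the infimum of all $s\geq 0$ such that for all $\epsilon>0$ and all $\delta_0>0$ there exist $0<\delta\leq\delta_0$ and a cover $\{U_i\}$ of $F$ with $\delta^{1/\theta}\leq |U_i|\leq\delta$ for all $i$ and $\sum_i |U_i|^s\leq\epsilon$. The upper $\theta$-intermediate dimension $\overline{\dim}_{\theta} F$ is the infimum of all $s\geq 0$ such that for all $\epsilon>0$ there exists $\delta_0>0$ such that for all $0<\delta\leq\delta_0$ there is a cover $\{U_i\}$ of $F$ with $\delta^{1/\theta}\leq |U_i|\leq\delta$ for all $i$ and $\sum_i |U_i|^s\leq\epsilon$. When $\theta=0$, $\delta^{1/\theta}$ is read as $0$ (no lower restriction on diameters), so that $\underline{\dim}_0F=\overline{\dim}_0F$ is the Hausdorff dimension of $F$; when $\theta=1$ these are the lower and upper box dimensions. *)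

(* Defs.v *)
From mathcomp Require Import all_boot all_order all_algebra.
From mathcomp Require Import all_classical all_reals all_analysis.

Set Implicit Arguments.
Unset Strict Implicit.
Unset Printing Implicit Defensive.

Import Order.TTheory GRing.Theory Num.Theory.

Local Open Scope classical_set_scope.
Local Open Scope ring_scope.

Section intermediate_dimension.
Context {R : realType}.
Implicit Types (F U : set R) (theta delta eps s : R).

(* The 0 is adjoined so that the empty set has diameter 0 and not -oo. *)
Definition diameter U : \bar R :=
  ereal_sup (0%E |` [set `|x - y|%:E | x in U & y in U]).

(* delta^(1/theta), read as 0 when theta = 0; the case split is needed because
   0^-1 = 0 would make the power equal to 1. *)
Definition lower_scale theta delta : R :=
  if theta == 0 then 0 else delta `^ (theta^-1).

(* The cover is the family (U i) indexed by i in I, where I is any (finite or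
   infinite, possibly empty) set of naturals. With `poweR`, 0 ^ 0 = 1; this
   only concerns s = 0 and so does not affect the infima below. *)
Definition has_cover theta F s delta eps : Prop :=
  exists (I : set nat) (U : nat -> set R),
    [/\ F `<=` \bigcup_(i in I) U i,
        forall i, I i ->
          ((lower_scale theta delta)%:E <= diameter (U i) <= delta%:E)%E &
        (\esum_(i in I) (diameter (U i) `^ s) <= eps%:E)%E].

Definition lower_intermediate_dim theta F : \bar R :=
  ereal_inf [set s%:E | s in [set s : R | 0 <= s /\
    forall eps delta0 : R, 0 < eps -> 0 < delta0 ->
      exists delta : R, 0 < delta <= delta0 /\
        has_cover theta F s delta eps]].

Definition upper_intermediate_dim theta F : \bar R :=
  ereal_inf [set s%:E | s in [set s : R | 0 <= s /\
    forall eps : R, 0 < eps ->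
      exists delta0 : R, 0 < delta0 /\
        forall delta : R, 0 < delta <= delta0 ->
          has_cover theta F s delta eps]].

Definition power_sequence_set (p : R) : set R :=
  [set x | x = 0 \/ exists n : nat, (0 < n)%N /\ x = 1 / (n%:R `^ p)].

End intermediate_dimension.

(* Main.v *)
(* Let t = theta / (p + theta), i.e. p t = theta (1 - t), let r = delta^(1/theta)
   be the smallest admissible diameter and M ~ r^(-t).
   Upper bound: cover the M largest points by intervals of length r and [0, M^-p]
   by intervals of length delta; the choice of M balances the two contributions,
   and the s-sum is at most 4 delta^(s - t) for every s > t.
   Lower bound: consecutive points among the M largest are at least p M^-(p+1)
   apart, so a set of diameter d contains at most 1 + d M^(p+1) / p of them, which
   for r <= d <= delta is at most a constant times r^(-t) d^t. As every point is
   covered, the t-sum of any admissible cover is bounded below by a constant.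
   For theta = 0 the countable set is covered by singletons. *)
Require Import Defs.
From mathcomp Require Import all_boot all_order all_algebra.
From mathcomp Require Import all_classical all_reals all_analysis.
From mathcomp Require Import ring lra.
Import Order.TTheory GRing.Theory Num.Theory.
Local Open Scope ring_scope.

(** * Spacing of negative powers, and diameters *)

(** A mean value bound. Dividing by [y ^ (-p)] and setting [u = x / y] reduces it to
    [1 + p (1 - u) <= u ^ (-p)], which follows from [exp v >= 1 + v] at [v = - p ln u] and from
    [ln u <= u - 1]. *)
Lemma powRN_diff_ge (R : realType) (p x y : R) : 0 < p -> 0 < x -> x <= y ->
  p * (y - x) * y `^ (- (p + 1)) <= x `^ (- p) - y `^ (- p).
Proof.
move=> p0 x0 xy; have y0 : 0 < y by exact: lt_le_trans xy.
have -> : y `^ (- (p + 1)) = y `^ (- p) / y.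
  by rewrite opprD powRD ?(gt_eqF y0) ?implybT// powR_inv1// ltW.
have -> : x `^ (- p) = y `^ (- p) * (x / y) `^ (- p).
  rewrite -powRM ?divr_ge0 ?ltW// mulrCA divff ?gt_eqF// mulr1 //.
have xy0 : 0 < x / y by rewrite divr_gt0.
have : 1 + p * (1 - x / y) <= (x / y) `^ (- p).
  rewrite /powR gt_eqF//; apply: le_trans (expR_ge1Dx _).
  rewrite lerD2l mulNr -mulrN ler_pM2l// lerNr opprB.
  have := @le_ln1Dx _ (x / y - 1); rewrite subrKC; apply.
  by rewrite ltrBrDl addrN.
rewrite -(ler_pM2l (powR_gt0 (- p) y0)) mulrDr mulr1 -lerBrDl; apply: le_trans.
rewrite le_eqVlt; apply/orP; left; apply/eqP; field; exact: lt0r_neq0.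
Qed.

Local Open Scope classical_set_scope.

Lemma diameter_ge (R : realType) (U : set R) x y : U x -> U y ->
  (`|x - y|%:E <= diameter U)%E.
Proof. by move=> Ux Uy; apply: ereal_sup_ubound; right; exists x => //; exists y. Qed.

Lemma diameter_ge0 (R : realType) (U : set R) : (0 <= diameter U)%E.
Proof. by apply: ereal_sup_ubound; left. Qed.

Lemma diameter_itv (R : realType) (a d : R) : 0 <= d ->
  diameter `[a, a + d] = d%:E.
Proof.
move=> d0; apply/eqP; rewrite eq_le; apply/andP; split.
  apply: ge_ereal_sup => _ [->|[x + [y + <-]]]; rewrite lee_fin //= !in_itv/=.
  by move=> ? ?; rewrite ler_norml; lra.
have : (`|a + d - a|%:E <= diameter `[a, (a + d)%R])%E.
  by apply: diameter_ge; rewrite /= in_itv/=; lra.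
by rewrite addrAC subrr add0r ger0_norm.
Qed.

Lemma diameter_set1 (R : realType) (a : R) : diameter [set a] = 0%E.
Proof. by have := diameter_itv R a 0 (lexx 0); rewrite addr0 set_itv1. Qed.

Lemma has_cover_le (R : realType) (theta s delta e1 e2 : R) (F : set R) :
  e1 <= e2 -> has_cover theta F s delta e1 -> has_cover theta F s delta e2.
Proof.
move=> e12 [I [U [FU Ud Us]]]; exists I, U; split=> //.
by apply: le_trans Us _; rewrite lee_fin.
Qed.

(** If [k] and [l] are the extreme indices in [A], then [A] has at most [1 + (l - k)] elements,
    while the two extreme points are at least [p (l - k) M ^ (- (p + 1))] apart because
    [l.+1 <= M]. *)
Lemma card_powRN_le (R : realType) (p d : R) (M : nat) (A : {set 'I_M}) :
  0 < p -> 0 <= d ->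
  (forall k l, k \in A -> l \in A ->
     `|k.+1%:R `^ (- p) - l.+1%:R `^ (- p)| <= d) ->
  #|A|%:R <= 1 + d * (M%:R `^ (p + 1) / p).
Proof.
move=> p0 d0 Ad; have [->|[a aA]] := set_0Vmem A.
  rewrite cards0 addr_ge0// mulr_ge0// divr_ge0 ?powR_ge0 ?ltW//.
case: (arg_minnP val aA) => k kA kmin; case: (arg_maxnP val aA) => l lA lmax.
have kl : (k <= l)%N by exact: kmin.
have M0 : (0 : R) < M%:R by rewrite ltr0n (leq_ltn_trans _ (ltn_ord k)).
have cA : (#|A| <= (l - k).+1)%N.
  rewrite cardE -(size_map val) -(size_iota k (l - k).+1) uniq_leq_size//.
    by rewrite map_inj_uniq ?enum_uniq//; exact: val_inj.
  move=> _ /mapP[i + ->]; rewrite mem_enum mem_iota addnS addnC subnK// => iA.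
  by rewrite ltnS kmin//; exact: lmax.
apply: (@le_trans _ _ (1 + (l - k)%:R)); first by rewrite addrC natr1 ler_nat.
rewrite lerD2l mulrA ler_pdivlMr// natrB//.
have := powRN_diff_ge R p k.+1%:R l.+1%:R p0 (ltr0Sn _ _).
rewrite ler_nat ltnS => /(_ kl) h.
have dle : k.+1%:R `^ (- p) - l.+1%:R `^ (- p) <= d.
  by apply: le_trans (Ad _ _ kA lA); exact: ler_norm.
have Mp : (0 : R) < M%:R `^ (p + 1) by exact: powR_gt0.
rewrite -ler_pdivrMr// mulrC -powRN.
have -> : l%:R - k%:R = l.+1%:R - k.+1%:R :> R by rewrite -!natr1; ring.
apply: le_trans dle; apply: le_trans h.
rewrite mulrC (mulrC _ p) ler_wpM2l//.
  by apply: mulr_ge0; rewrite ?(ltW p0)// subr_ge0 ler_nat.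
rewrite !powRN lef_pV2 ?posrE ?powR_gt0// ge0_ler_powR ?nnegrE//.
- by rewrite addr_ge0 ?ltW.
- by rewrite ler_nat.
Qed.

(** * Estimates for covers at one fixed scale [delta] *)

Section covers_of_power_sequence.
Variables (R : realType) (p theta t delta : R).
Hypotheses (p_gt0 : 0 < p) (theta_gt0 : 0 < theta) (theta_le1 : theta <= 1).
Hypotheses (t_gt0 : 0 < t) (t_lt1 : t < 1) (tE : p * t = theta * (1 - t)).
Hypotheses (delta_gt0 : 0 < delta) (delta_le1 : delta <= 1).

Let r := delta `^ theta^-1.
Let M := (Num.truncn (r `^ (- t))).+1.

Let r_gt0 : 0 < r. Proof. exact: powR_gt0. Qed.

Let powr x : r `^ x = delta `^ (x / theta).
Proof. by rewrite /r -powRrM mulrC. Qed.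

Let powDd x y : delta `^ (x + y) = delta `^ x * delta `^ y.
Proof. by rewrite powRD// (gt_eqF delta_gt0) implybT. Qed.

Let r_le_delta : r <= delta.
Proof. by rewrite ge1r_powR ?delta_gt0// invf_ge1. Qed.

Let M_gt : r `^ (- t) < M%:R. Proof. exact: truncnS_gt. Qed.

Let M_le : M%:R <= r `^ (- t) + 1.
Proof. by rewrite -natr1 lerD2r truncn_le powR_ge0. Qed.

Let M_gt0 : (0 : R) < M%:R. Proof. by rewrite ltr0n. Qed.

Let power_in (k : nat) : power_sequence_set p (k.+1%:R `^ (- p)).
Proof. by right; exists k.+1; rewrite powRN div1r. Qed.

Let lower_scaleE : lower_scale theta delta = r.
Proof. by rewrite /lower_scale gt_eqF. Qed.

(* [(p + theta) t = theta] makes both terms of the count [1 + d M^(p+1) / p] of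
   a set of diameter [d] comparable to [r^(-t) d^t]. *)
Lemma has_cover_ge (s eps : R) : s <= t ->
  has_cover theta (power_sequence_set p) s delta eps ->
  1 <= (1 + 2 `^ (p + 1) / p) * eps.
Proof.
move=> st [I [U [FU Ud Us]]]; set C := 2 `^ (p + 1) / p.
have C0 : 0 <= C by rewrite divr_ge0 ?powR_ge0 ?ltW.
have rt0 : 0 < r `^ (- t) by exact: powR_gt0.
have rt1 : 1 <= r `^ (- t).
  rewrite powRN invf_ge1 ?powR_gt0// -(powRr0 r) ger_powR ?(ltW t_gt0)//.
  by rewrite r_gt0 (le_trans r_le_delta).
(* This is where the factor [2 ^ (p + 1)] in [C] comes from. *)
have M2 : M%:R <= 2 * r `^ (- t) by have := M_le; lra.
pose d i := fine (diameter (U i)).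
have dE i : I i -> diameter (U i) = (d i)%:E /\ r <= d i <= delta.
  move=> /Ud; rewrite lower_scaleE /d.
  by case: (diameter _) => [x| |]//=; rewrite ?lee_fin// leye_eq andbF.
have /choice[f fP] : forall k : 'I_M, exists i, I i /\ U i (k.+1%:R `^ (- p)).
  by move=> k; have [i Ii Ui] := FU _ (power_in k); exists i.
(* Each of the [M] largest points is assigned one member of the cover containing it. Only finitely
   many indices are hit, so the fibres of [g] partition these points over a finite type. *)
pose n := (\max_k f k).+1.
pose g k : 'I_n := inord (f k).
have gE k : g k = f k :> nat by rewrite inordK// ltnS leq_bigmax.
have cardP (j : 'I_n) : `[< I j >] ->
    (#|[set k | g k == j]%SET|)%:R <= r `^ (- t) * (1 + C) * d j `^ s.
  move=> /asboolP Ij; have [Uj /andP[rd dd]] := dE _ Ij.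
  have d0 : 0 < d j by exact: lt_le_trans rd.
  (* Since [d j <= delta <= 1] and [s <= t], it is enough to bound the fibre with exponent [t]. *)
  have dts : d j `^ t <= d j `^ s by rewrite ger_powR ?d0 ?(le_trans dd).
  apply: (@le_trans _ _ (r `^ (- t) * (1 + C) * d j `^ t)); last first.
    by rewrite ler_wpM2l// mulr_ge0 ?ltW// ltr_wpDr.
  apply: (@le_trans _ _ (1 + d j * (M%:R `^ (p + 1) / p))).
    apply: card_powRN_le => // [|k l]; first exact: ltW.
    rewrite !inE => /eqP gk /eqP gl.
    have [[_ Uk] [_ Ul]] := (fP k, fP l).
    by rewrite -lee_fin -Uj; apply: diameter_ge; rewrite -?gE ?gk ?gl in Uk Ul *.
  (* The two terms of the count are compared separately; the first needs only
     [1 <= r ^ (-t) * d ^ t], which is [r <= d]. *)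
  rewrite mulrDr mulr1 mulrDl lerD//.
    rewrite powRN mulrC ler_pdivlMr ?powR_gt0// mul1r.
    by rewrite ge0_ler_powR ?nnegrE ?(ltW t_gt0) ?(ltW r_gt0) ?(ltW d0).
  have Mp : M%:R `^ (p + 1) <= 2 `^ (p + 1) * r `^ (- t * (p + 1)).
    rewrite powRrM -powRM ?(ltW rt0)// ge0_ler_powR ?nnegrE ?(ltW M_gt0)//.
      by rewrite addr_ge0 ?ltW.
    by rewrite mulr_ge0 ?ltW.
  apply: (@le_trans _ _ (d j * (2 `^ (p + 1) * r `^ (- t * (p + 1)) / p))).
    by rewrite ler_wpM2l ?(ltW d0)// ler_wpM2r// invr_ge0 ltW.
  (* By [tE] and [r ^ theta = delta], the factor [r ^ (- t p)] is [delta ^ (t - 1)]. As [t < 1] and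
     [d <= delta], this is at most [d ^ (t - 1)]. *)
  have -> : r `^ (- t * (p + 1)) = r `^ (- t) * delta `^ (t - 1).
    rewrite !powr -powDd; congr (_ `^ _).
    have -> : - t * (p + 1) = - t + theta * (t - 1)
      by rewrite mulrDr mulr1 mulNr (mulrC t) tE; ring.
    by field; rewrite gt_eqF.
  have -> : d j `^ t = d j * d j `^ (t - 1) by rewrite mulr_powRB1 ?ltW.
  have -> : d j * (2 `^ (p + 1) * (r `^ (- t) * delta `^ (t - 1)) / p) =
            r `^ (- t) * C * d j * delta `^ (t - 1) by rewrite /C; ring.
  rewrite [leRHS]mulrA ler_wpM2l//; first by rewrite mulr_ge0 ?(ltW d0)// mulr_ge0 ?(ltW rt0).
  have -> : t - 1 = - (1 - t) by ring.
  rewrite !powRN lef_pV2 ?posrE ?powR_gt0// ge0_ler_powR ?nnegrE ?(ltW d0) ?(ltW delta_gt0)//.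
  by rewrite subr_ge0 ltW.
have sumd : \sum_(j < n | `[< I j >]) d j `^ s <= eps.
  have IE : I = [set x | `[< I x >]] by apply/seteqP; split=> x /asboolP.
  rewrite -lee_fin; apply: le_trans Us; rewrite [X in esum X]IE.
  rewrite -nneseries_esum; last by move=> i _; exact: poweR_ge0.
  have := @nneseries_lim_ge R (fun i => diameter (U i) `^ s)%E (fun i => `[< I i >])
    0 n (fun i _ _ => poweR_ge0 _ _).
  apply: le_trans; rewrite big_mkord -sumEFin le_eqVlt; apply/orP; left; apply/eqP.
  by apply: eq_bigr => j /asboolP/dE[-> _]; rewrite poweR_EFin.
(* Summing the fibre sizes counts all [M] points; since [M > r ^ (-t)], cancelling that power leaves
   a bound independent of [delta]. *)
have : M%:R <= r `^ (- t) * (1 + C) * eps.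
  have -> : M = (\sum_(j < n | `[< I j >]) #|[set k | g k == j]%SET|)%N.
    rewrite -[LHS]card_ord -sum1_card.
    rewrite (partition_big g (fun j : 'I_n => `[< I j >])); last first.
      by move=> k _; apply/asboolP; rewrite gE; have [] := fP k.
    by apply: eq_bigr => j _; rewrite -sum1_card; apply: eq_bigl => k; rewrite inE.
  rewrite natr_sum; apply: le_trans (ler_sum _ cardP) _.
  by rewrite -mulr_sumr ler_wpM2l// mulr_ge0 ?ltW// ltr_wpDr.
move=> /(lt_le_trans M_gt); rewrite -mulrA -[ltLHS]mulr1 ltr_pM2l//; exact: ltW.
Qed.

(** The constant 4 counts the terms of [(r ^ (-t) + 1) * r ^ s] and
    [(r ^ (t p) / delta + 1) * delta ^ s], each of which is at most [delta ^ (s - t)]. *)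
Lemma has_cover_powR (s : R) : t < s ->
  has_cover theta (power_sequence_set p) s delta (4 * delta `^ (s - t)).
Proof.
move=> ts; pose N := (Num.truncn (M%:R `^ (- p) / delta)).+1.
(* The first [M] intervals start at the largest points and have length [r], the least diameter
   allowed; the next [N], of length [delta], tile [[0, M ^ (-p)]]. *)
pose U i := if (i < M)%N then `[i.+1%:R `^ (- p), (i.+1%:R `^ (- p) + r)%R]
            else `[(i - M)%:R * delta, ((i - M)%:R * delta + delta)%R].
pose d i := if (i < M)%N then r else delta.
have UE i : diameter (U i) = (d i)%:E.
  by rewrite /U /d; case: ifP => _; rewrite diameter_itv// ltW.
have tail x : 0 <= x <= M%:R `^ (- p) -> exists2 i, (i < M + N)%N & U i x.
  move=> /andP[x0 xM].
  have /truncn_itv/andP[k1 k2] : 0 <= x / delta by rewrite divr_ge0// ltW.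
  exists (M + Num.truncn (x / delta))%N.
    rewrite ltn_add2l ltnS le_truncn// ler_pM2r ?invr_gt0//.
  rewrite /U ltnNge leq_addr/= addKn in_itv/= -ler_pdivlMr// k1/=.
  by move: k2; rewrite ltr_pdivrMr// -natr1 mulrDl mul1r => /ltW.
exists `I_(M + N), U; split.
- move=> x Fx; suff [i iMN Ux] : exists2 i, (i < M + N)%N & U i x by exists i.
  case: Fx => [->|[[|k] [//= _ ->]]]; first by apply: tail; rewrite lexx powR_ge0.
  rewrite div1r -powRN; have [kM|Mk] := ltnP k M.
    exists k; first exact: ltn_addr.
    by rewrite /U kM/= in_itv/= lexx lerDl ltW.
  apply: tail; rewrite powR_ge0/= !powRN lef_pV2 ?posrE ?powR_gt0//.
  by rewrite ge0_ler_powR ?nnegrE ?(ltW p_gt0)// ler_nat ltnW.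
- move=> i _; rewrite UE lower_scaleE !lee_fin /d.
  by case: ifP => _; rewrite !lexx ?r_le_delta.
rewrite esum_fset//; last by move=> i _; exact: poweR_ge0.
rewrite -fsbig_ord.
under eq_bigr do rewrite UE poweR_EFin.
rewrite sumEFin lee_fin big_split_ord/=.
under eq_bigr do rewrite /d ltn_ord.
under [X in _ + X]eq_bigr do rewrite /d ltnNge leq_addr/=.
rewrite !sumr_const !card_ord -mulr_natl -[X in _ + X]mulr_natl.
have N_le : N%:R <= r `^ (t * p) / delta + 1.
  rewrite -natr1 lerD2r (@le_trans _ _ (M%:R `^ (- p) / delta))//.
    by rewrite truncn_le divr_ge0 ?powR_ge0// ltW.
  rewrite ler_pM2r ?invr_gt0// -[t * p]mulrNN powRrM !(powRN _ p).
  rewrite lef_pV2 ?posrE ?powR_gt0// ge0_ler_powR ?nnegrE ?powR_ge0 ?(ltW p_gt0)//.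
  exact: ltW.
have st_le : s - t <= (s - t) / theta.
  by rewrite ler_pdivlMr// ler_piMr// subr_ge0 ltW.
have rs : r `^ s <= delta `^ (s - t).
  rewrite powr ger_powR ?delta_gt0// (le_trans st_le)//.
  by rewrite ler_pM2r ?invr_gt0// gerBl ltW.
have rts : r `^ (- t) * r `^ s <= delta `^ (s - t).
  by rewrite !powr -powDd ger_powR ?delta_gt0// -mulrDl (addrC _ s).
have ds : delta `^ s <= delta `^ (s - t).
  by rewrite ger_powR ?delta_gt0// gerBl ltW.
(* The balance between the two blocks: [tE] gives [r ^ (t p) = delta ^ (1 - t)]. *)
have rps : r `^ (t * p) / delta * delta `^ s = delta `^ (s - t).
  rewrite -[delta^-1](powR_inv1 (ltW delta_gt0)) powr -!powDd; congr (_ `^ _).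
  by rewrite (mulrC t) tE; field; rewrite gt_eqF.
have MM : M%:R * r `^ s <= (r `^ (- t) + 1) * r `^ s by rewrite ler_wpM2r ?powR_ge0.
have NN : N%:R * delta `^ s <= (r `^ (t * p) / delta + 1) * delta `^ s.
  by rewrite ler_wpM2r ?powR_ge0.
rewrite mulrDl rps in NN; rewrite mulrDl in MM; lra.
Qed.

End covers_of_power_sequence.

(** * The case [theta = 0] and the passage to dimensions *)

Lemma has_cover0_power_sequence (R : realType) (p s delta eps : R) :
  0 < s -> 0 <= delta -> 0 <= eps ->
  has_cover 0 (power_sequence_set p) s delta eps.
Proof.
move=> s0 delta0 eps0.
(* The sequence starts at 1, so index 0 is free for the limit point 0. *)
pose U (n : nat) : set R := [set if n is 0%N then 0 else 1 / n%:R `^ p].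
have UE n : diameter (U n) = 0%E by exact: diameter_set1.
exists setT, U; split.
- by move=> x [->|[[|n] [//= _ ->]]]; [exists 0%N|exists n.+1].
- by move=> n _; rewrite UE /lower_scale eqxx lexx lee_fin.
- by rewrite esum1 ?lee_fin// => n _; rewrite UE poweR0r ?gt_eqF.
Qed.

Lemma lower_le_upper_intermediate_dim (R : realType) (theta : R) (F : set R) :
  (lower_intermediate_dim theta F <= upper_intermediate_dim theta F)%E.
Proof.
apply: ereal_inf_le_tmp => _ [s [s0 sF] <-]; exists s => //.
split=> // eps d0 eps0 d0_gt0.
have [d1 [d1_gt0 cov]] := sF _ eps0.
have d_gt0 : 0 < Num.min d0 d1 by rewrite lt_min d0_gt0.
exists (Num.min d0 d1); rewrite d_gt0 ge_min lexx; split=> //.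
by apply: cov; rewrite d_gt0 ge_min lexx orbT.
Qed.

Lemma upper_intermediate_dim_power_sequence_le (R : realType) (p theta : R) :
  0 < p -> 0 <= theta -> theta <= 1 ->
  (upper_intermediate_dim theta (power_sequence_set p) <=
     (theta / (p + theta))%:E)%E.
Proof.
move=> p0 th0 th1; set t := theta / (p + theta).
have t0 : 0 <= t by rewrite divr_ge0 ?addr_ge0// ltW.
apply/lee_addgt0Pr => e e0; apply: ereal_inf_lbound; exists (t + e) => //.
have te : t < t + e by rewrite ltrDl.
have te0 : 0 < t + e by exact: le_lt_trans te.
split=> [|eps eps0]; first exact: ltW.
have [th|th_neq0] := eqVneq theta 0.
  exists 1; split=> // d /andP[d0 _]; rewrite th.
  by apply: has_cover0_power_sequence => //; exact: ltW.
have th_gt0 : 0 < theta by rewrite lt_neqAle eq_sym th_neq0.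
have pth : 0 < p + theta by rewrite addr_gt0.
(* The second bound solves [4 * d ^ e <= eps]; the first gives [d <= 1], as the cover estimate
   requires. *)
exists (Num.min 1 ((eps / 4) `^ e^-1)).
rewrite lt_min ltr01 powR_gt0 ?divr_gt0//; split=> // d.
rewrite le_min => /and3P[d0 d1 deps].
have : has_cover theta (power_sequence_set p) (t + e) d (4 * d `^ (t + e - t)).
  apply: has_cover_powR => //; first by rewrite divr_gt0.
  by rewrite /t; field; rewrite gt_eqF.
apply: has_cover_le; rewrite addrAC subrr add0r mulrC -ler_pdivlMr//.
have -> : eps / 4 = ((eps / 4) `^ e^-1) `^ e.
  by rewrite -powRrM mulVf ?gt_eqF// powRr1// divr_ge0// ltW.
by rewrite ge0_ler_powR ?nnegrE ?powR_ge0 ?(ltW e0) ?(ltW d0).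
Qed.

Lemma lower_intermediate_dim_power_sequence_ge (R : realType) (p theta : R) :
  0 < p -> 0 <= theta -> theta <= 1 ->
  ((theta / (p + theta))%:E <=
     lower_intermediate_dim theta (power_sequence_set p))%E.
Proof.
move=> p0 th0 th1; apply: le_ereal_inf_tmp => _ [s [s0 sF] <-].
rewrite lee_fin; set t := theta / (p + theta).
have [th|th_neq0] := eqVneq theta 0; first by rewrite /t th mul0r.
have th_gt0 : 0 < theta by rewrite lt_neqAle eq_sym th_neq0.
have pth : 0 < p + theta by rewrite addr_gt0.
rewrite leNgt; apply/negP => st.
pose C : R := 1 + 2 `^ (p + 1) / p.
have C0 : 0 < C by rewrite ltr_wpDr// divr_ge0 ?powR_ge0// ltW.
(* With [eps = 1 / (2 C)] the uniform bound [1 <= C * eps] would read [1 <= 1 / 2]. *)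
have [|//|d [/andP[d0 d1] cov]] := sF (2 * C)^-1 1; first by rewrite invr_gt0 mulr_gt0.
have : 1 <= C * (2 * C)^-1.
  apply: (has_cover_ge R p theta t d _ _ _ _ _ _ _ _ s) => //.
  - by rewrite divr_gt0.
  - by rewrite ltr_pdivrMr// mul1r ltrDr.
  - by rewrite /t; field; rewrite gt_eqF.
  - exact: ltW.
by rewrite invfM mulrCA divff ?gt_eqF// mulr1 invf_ge1// leNgt ltr1n.
Qed.

Theorem proposition3p1 (R : realType) (p theta : R)
    (p_gt0 : 0 < p) (theta_ge0 : 0 <= theta) (theta_le1 : theta <= 1) :
  lower_intermediate_dim theta (power_sequence_set p) =
    upper_intermediate_dim theta (power_sequence_set p) /\
  upper_intermediate_dim theta (power_sequence_set p) =
    (theta / (p + theta))%:E.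
Proof.
have lu := lower_le_upper_intermediate_dim R theta (power_sequence_set p).
have ut := upper_intermediate_dim_power_sequence_le R p theta p_gt0 theta_ge0 theta_le1.
have tl := lower_intermediate_dim_power_sequence_ge R p theta p_gt0 theta_ge0 theta_le1.
have uE : upper_intermediate_dim theta (power_sequence_set p) = (theta / (p + theta))%:E.
  by apply/eqP; rewrite eq_le ut (le_trans tl).
by split=> //; apply/eqP; rewrite eq_le lu uE tl.
Qed.
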